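(* Let $E$ be a directed graph that satisfies condition (L), let $K$ be a field, and suppose that the only saturated and hereditary subsets of $E^0$ are $\emptyset$ and $E^0$. Then $D(X)\rtimes_\alpha\mathbb{F}$ is simple.
   Context: **Graph.** $E=(E^0,E^1,r,s)$ is a directed graph with vertex set $E^0$, edge set $E^1$, and range and source maps $r,s:E^1\to E^0$ (no finiteness assumption). A sink is a vertex $v$ with $s^{-1}(v)=\emptyset$. $W$ is the set of finite paths of length at least $1$: words $\xi_1\cdots\xi_n$, $n\ge 1$, $\xi_i\in E^1$, $r(\xi_i)=s(\xi_{i+1})$. $W^\infty$ is the set of infinite paths $\xi_1\xi_2\xi_3\cdots$, $r(\xi_i)=s(\xi_{i+1})$ for all $i$. Extend $s(\xi)=s(\xi_1)$ for $\xi\in W\cup W^\infty$, $r(\xi_1\cdots\xi_n)=r(\xi_n)$, and $r(v)=s(v)=v$ for $v\in E^0$. $|a|$ is the length of $a\in W$. **Condition (L).** Every closed path has an exit: for every $b=b_1\cdots b_n\in W$ with $s(b)=r(b)$ there exist $i$ and an edge $t\in E^1$ with $s(t)=s(b_i)$ and $t\ne b_i$. **Hereditary, saturated.** $H\subseteq E^0$ is hereditary if for every $e\in E^1$ with $s(e)\in H$ we have $r(e)\in H$. $H\subseteq E^0$ is saturated if for every $v\in E^0$ with $0<|s^{-1}(v)|<\infty$, the inclusion $\{r(e):e\in E^1,\ s(e)=v\}\subseteq H$ implies $v\in H$. **Simple.** An algebra is simple here if it has no two-sided ideals other than $0$ and itself. **Sets.** $\mathbb{F}$ is the free group generated by $E^1$,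 with neutral element denoted $0$; $W$ is viewed as a subset of $\mathbb{F}$. Let $X=\{\xi\in W: r(\xi)\text{ is a sink}\}\cup\{v\in E^0: v\text{ is a sink}\}\cup W^\infty$. Define $X_0=X$; for $b\in W$, $X_{b^{-1}}=\{\xi\in X: s(\xi)=r(b)\}$; for $a\in W$, $X_a=\{\xi\in X:\xi_1\cdots\xi_{|a|}=a\}$; for $a,b\in W$ with $r(a)=r(b)$ and $ab^{-1}$ reduced (i.e. $a_{|a|}\ne b_{|b|}$), $X_{ab^{-1}}=X_a$; and $X_c=\emptyset$ for all other $c\in\mathbb{F}$. For $v\in E^0$, $X_v=\{\xi\in X:s(\xi)=v\}$. **Partial action on $X$.** $\theta_0=\mathrm{id}_X$; for $b\in W$, $\theta_b:X_{b^{-1}}\to X_b$, $\theta_b(\xi)=b\xi$ (with $b\,r(b)=b$ when $r(b)$ is a sink), and $\theta_{b^{-1}}=\theta_b^{-1}$; for $a,b\in W$ with $r(a)=r(b)$, $a_{|a|}\neq b_{|b|}$, $\theta_{ab^{-1}}:X_{ba^{-1}}\to X_{ab^{-1}}$, $\theta_{ab^{-1}}(\xi)=a\xi_{|b|+1}\xi_{|b|+2}\cdots$; otherwise $\theta_c$ is the empty map. **Algebras.** $F(X)$ is the $K$-algebra of functions $X\to K$ with pointwise operations; $F(X_c)$ is the ideal of functions vanishing outside $X_c$; $\alpha_c:F(X_{c^{-1}})\to F(X_c)$ is $\alpha_c(f)=f\circ\theta_{c^{-1}}$ (extended by zero outside $X_c$). $1_c$ and $1_v$ are the characteristic functions of $X_c$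 ($c\in\mathbb{F}$) and $X_v$ ($v\in E^0$). Let $D(X)=D_0$ be the $K$-linear span of $\{1_p:p\in\mathbb{F}\setminus\{0\}\}\cup\{1_v:v\in E^0\}$, and for $p\in\mathbb{F}\setminus\{0\}$ let $D_p=1_pD_0$, the $K$-linear span of $\{1_p1_q:q\in\mathbb{F}\}$. Each $\alpha_p$ restricts to an isomorphism $D_{p^{-1}}\to D_p$, giving a partial action of $\mathbb{F}$ on $D_0$. **Partial skew group ring.** $D(X)\rtimes_\alpha\mathbb{F}$ is the $K$-algebra of finite formal sums $\sum_{p\in\mathbb{F}}a_p\delta_p$ with $a_p\in D_p$, with componentwise linear structure and product determined by $(a_p\delta_p)(b_q\delta_q)=\alpha_p(\alpha_{p^{-1}}(a_p)b_q)\delta_{pq}$. *)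

(* Defs.v *)
From HB Require Import structures.
From mathcomp Require Import all_boot all_algebra all_classical.
From mathcomp Require Import numfun.

Set Implicit Arguments.
Unset Strict Implicit.
Unset Printing Implicit Defensive.

Import GRing.Theory.
Local Open Scope classical_set_scope.
Local Open Scope ring_scope.

(* The free group on an alphabet T: its elements are the reduced words in the *)
(* letters (t, true), which stands for t, and (t, false), which stands for    *)
(* t^-1.                                                                      *)

Section FreeGroup.
Variable T : choiceType.
Implicit Types (x : T * bool) (u v w : seq (T * bool)).

Definition letter_inv x := (x.1, ~~ x.2).

Definition reduced w := sorted (fun x y => y != letter_inv x) w.

Record free_group := FreeGroup {
  fg_word :> seq (T * bool);
  fg_wordP : reduced fg_word
}.

HB.instance Definition _ := [isSub for fg_word].
HB.instance Definition _ := [Choice of free_group by <:].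

Definition push x w :=
  if w is y :: w' then if y == letter_inv x then w' else x :: w else [:: x].

Lemma letter_invK : involutive letter_inv.
Proof. by case=> t b; rewrite /letter_inv /= negbK. Qed.

Lemma push_reduced x w : reduced w -> reduced (push x w).
Proof.
case: w => [//|y w] /= rw; case: eqP => [_|/eqP nxy].
  exact: path_sorted rw.
by rewrite /= nxy.
Qed.

Lemma foldr_push_reduced u w : reduced w -> reduced (foldr push w u).
Proof. by move=> rw; elim: u => //= x u; apply: push_reduced. Qed.

Lemma push_cons x w : reduced (x :: w) -> push x w = x :: w.
Proof. by case: w => [//|y w] /= /andP[/negPf->]. Qed.

Lemma pushK x w : reduced w -> push x (push (letter_inv x) w) = w.
Proof.
case: w => [_|y w rw] /=; first by rewrite eqxx.
rewrite letter_invK; case: eqP => [eyx|_]; last by rewrite /= eqxx.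
by rewrite -eyx push_cons.
Qed.

Lemma foldr_pushA u v w : reduced w ->
  foldr push (foldr push w v) u = foldr push w (foldr push v u).
Proof.
move=> rw; elim: u => [//|x u /= ->].
case: (foldr push v u) => [//|y z] /=; case: eqP => [->|//].
by rewrite pushK// foldr_push_reduced.
Qed.

Definition word_inv w := rev [seq letter_inv x | x <- w].

Lemma word_invK : involutive word_inv.
Proof.
by move=> w; rewrite /word_inv map_rev revK -map_comp map_id_in // => x _ /=;
  rewrite letter_invK.
Qed.

Lemma word_inv_reduced w : reduced w -> reduced (word_inv w).
Proof.
rewrite /reduced /word_inv rev_sorted sorted_map; apply: sub_sorted => x y /=.
by apply: contra => /eqP/(inv_inj letter_invK)->; rewrite letter_invK.
Qed.

Lemma foldr_push_inv w : foldr push w (word_inv w) = [::].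
Proof.
elim: w => [//|x w IHw].
by rewrite /word_inv /= rev_cons foldr_rcons /= letter_invK eqxx.
Qed.

Lemma foldr_push_nil w : reduced w -> foldr push [::] w = w.
Proof.
elim: w => [//|x w IHw] rw /=.
by rewrite IHw ?push_cons //; apply: path_sorted rw.
Qed.

Definition fg_one := @FreeGroup [::] isT.

Definition fg_mul (g h : free_group) :=
  FreeGroup (foldr_push_reduced g (fg_wordP h)).

Definition fg_inv (g : free_group) := FreeGroup (word_inv_reduced (fg_wordP g)).

Lemma fg_mulA : associative fg_mul.
Proof. by move=> g h k; apply: val_inj; apply: foldr_pushA; apply: fg_wordP. Qed.

Lemma fg_mul1g : left_id fg_one fg_mul.
Proof. by move=> g; apply: val_inj. Qed.

Lemma fg_mulg1 : right_id fg_one fg_mul.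
Proof. by move=> g; apply: val_inj; apply: foldr_push_nil; apply: fg_wordP. Qed.

Lemma fg_mulVg : left_inverse fg_one fg_inv fg_mul.
Proof. by move=> g; apply: val_inj; apply: foldr_push_inv. Qed.

Lemma fg_mulgV : right_inverse fg_one fg_inv fg_mul.
Proof.
move=> g; apply: val_inj => /=.
by have := foldr_push_inv (word_inv g); rewrite word_invK.
Qed.

HB.instance Definition _ :=
  isGroup.Build free_group fg_mulA fg_mul1g fg_mulg1 fg_mulVg fg_mulgV.

Definition fg_gen (t : T) := @FreeGroup [:: (t, true)] isT.

(* The letters of g with exponent 1, in order, and those with exponent -1, in *)
(* reverse order: for a reduced product g = a b^-1 of positive words, these   *)
(* are a and b.                                                               *)
Definition fg_pos (g : free_group) := [seq x.1 | x <- fg_word g & x.2].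
Definition fg_neg (g : free_group) := rev [seq x.1 | x <- fg_word g & ~~ x.2].

End FreeGroup.

Record digraph := Digraph {
  vertex : Type;
  edge : Type;
  src : edge -> vertex;
  rng : edge -> vertex
}.

HB.instance Definition _ (E : digraph) := gen_eqMixin (vertex E).
HB.instance Definition _ (E : digraph) := gen_choiceMixin (vertex E).
HB.instance Definition _ (E : digraph) := gen_eqMixin (edge E).
HB.instance Definition _ (E : digraph) := gen_choiceMixin (edge E).

Section Graph.
Variable E : digraph.
Implicit Types (v : vertex E) (e : edge E) (H : set (vertex E)).

Definition sink v := [set e | src e = v] = set0.

Definition hereditary H := forall e, H (src e) -> H (rng e).

Definition saturated H := forall v,
  [set e | src e = v] !=set0 -> finite_set [set e | src e = v] ->
  (@rng E) @` [set e | src e = v] `<=` H -> H v.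

Definition composable : rel (edge E) := fun e f => rng e == src f.

(* The paths of length at least 1, given by their first edge and the list of  *)
(* the following ones.                                                        *)
Record finpath := FinPath {
  fp_head : edge E;
  fp_tail : seq (edge E);
  finpathP : path composable fp_head fp_tail
}.

Definition fp_seq (a : finpath) : seq (edge E) := fp_head a :: fp_tail a.
Definition fp_last (a : finpath) : edge E := last (fp_head a) (fp_tail a).
Definition fp_src (a : finpath) : vertex E := src (fp_head a).
Definition fp_rng (a : finpath) : vertex E := rng (fp_last a).

Definition condition_L := forall b : finpath, fp_src b = fp_rng b ->
  exists2 e, e \in fp_seq b & exists2 t, src t = src e & t <> e.

(* A vertex, a nonempty list of edges (split as in finpath), or a sequence of *)
(* edges; the endpoints of the edges need not match.                          *)
Inductive raw_path :=
| Vtx of vertex E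
| Fin of edge E & seq (edge E)
| Inf of nat -> edge E.

(* The set X: sinks, finite paths ending at a sink and infinite paths. *)
Definition boundary : set raw_path := fun x =>
  match x with
  | Vtx v => sink v
  | Fin e w => path composable e w /\ sink (rng (last e w))
  | Inf f => forall n, rng (f n) = src (f n.+1)
  end.

Definition raw_src (x : raw_path) : vertex E :=
  match x with Vtx v => v | Fin e _ => src e | Inf f => src (f 0%N) end.

(* The first n edges of x, or all of them if x has fewer than n. *)
Definition raw_take n (x : raw_path) : seq (edge E) :=
  match x with
  | Vtx _ => [::]
  | Fin e w => take n (e :: w)
  | Inf f => mkseq f n
  end.

Definition raw_cons e (x : raw_path) : raw_path :=
  match x with
  | Vtx _ => Fin e [::]
  | Fin f w => Fin e (f :: w)
  | Inf f => Inf (fun n => if n is n'.+1 then f n' else e)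
  end.

Definition raw_behead (x : raw_path) : raw_path :=
  match x with
  | Vtx v => Vtx v
  | Fin e w => if w is f :: w' then Fin f w' else Vtx (rng e)
  | Inf f => Inf (fun n => f n.+1)
  end.

Local Notation FF := (free_group (edge E)).

Definition fp_fg (a : finpath) : FF := (\prod_(e <- fp_seq a) fg_gen e)%g.

Implicit Types (x : boundary) (c : FF).

Definition Xsrc v : set boundary := [set x | raw_src (val x) = v].

Definition Xcyl (a : finpath) : set boundary :=
  [set x | raw_take (size (fp_seq a)) (val x) = fp_seq a].

(* The sets X_c; the four cases are mutually exclusive. *)
Definition Xset c : set boundary := [set x |
  [\/ c = 1%g,
      exists2 b, c = (fp_fg b)^-1%g & Xsrc (fp_rng b) x,
      exists2 a, c = fp_fg a & Xcyl a x
    | exists a b, [/\ fp_rng a = fp_rng b, fp_last a <> fp_last b,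
                      c = (fp_fg a * (fp_fg b)^-1)%g & Xcyl a x]]].

(* For c = a b^-1, with a and b paths or empty, this removes the first |b|    *)
(* edges of x and puts a in front of the rest; it is meaningful only if x is  *)
(* in X_(c^-1).                                                               *)
Definition raw_theta c (x : raw_path) : raw_path :=
  foldr raw_cons (iter (size (fg_neg c)) raw_behead x) (fg_pos c).

(* If x is in X_(c^-1), then raw_theta c (val x) is in X_c, so the default    *)
(* value x is used only outside the domain of theta_c.                        *)
Definition theta c x : boundary := insubd x (raw_theta c (val x)).

End Graph.

Arguments boundary : clear implicits.

Definition lin_span (K : fieldType) (V : lmodType K) (S : set V) : set V :=
  [set v | exists n (k : 'I_n -> K) (u : 'I_n -> V),
             (forall i, S (u i)) /\ v = \sum_(i < n) k i *: u i].

(* Two-sided ideals of the subset A of V, where A is a subgroup of V closed   *)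
(* under the biadditive product mul. For an algebra this is the notion of     *)
(* ring ideal: I is not required to be a linear subspace.                     *)
Definition two_sided_ideal (V : zmodType) (mul : V -> V -> V) (A I : set V) :=
  [/\ I `<=` A, I 0, (forall x y, I x -> I y -> I (x - y)),
      (forall a x, A a -> I x -> I (mul a x))
    & (forall a x, A a -> I x -> I (mul x a))].

Definition simple_algebra (V : zmodType) (mul : V -> V -> V) (A : set V) :=
  forall I, two_sided_ideal mul A I -> I = [set 0] \/ I = A.

Section PartialSkewGroupRing.
Variables (K : fieldType) (E : digraph).

Local Notation FF := (free_group (edge E)).
Local Notation FX := (boundary E -> K^o).

Implicit Types (f : FX) (p q c : FF).

Definition alpha c f : FX :=
  fun x => if x \in Xset c then f (theta c^-1%g x) else 0.

Definition D0 : set FX := lin_span (fun f =>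
  (exists2 p, p <> 1%g & f = \1_(Xset p)) \/ (exists v, f = \1_(Xsrc v))).

(* D 1 is D0, because \1_(Xset 1) is constantly equal to 1. *)
Definition D p : set FX := (fun f => \1_(Xset p) \* f) @` D0.

(* The formal sum of the a_p delta_p is the function p |-> a_p. *)
Definition skew_ring : set (FF -> FX) :=
  [set a | finite_set [set p | a p <> 0] /\ forall p, D p (a p)].

(* The coefficient at r is the sum over all p and q with p q = r, that is,    *)
(* q = p^-1 r; only finitely many of its terms are nonzero on skew_ring.      *)
Definition skew_mul (a b : FF -> FX) : FF -> FX := fun r =>
  \sum_(p \in [set: FF]) alpha p (alpha p^-1%g (a p) \* b (p^-1 * r)%g).

End PartialSkewGroupRing.

(* Main.v *)
Require Import Defs.
From mathcomp Require Import all_boot all_algebra all_classical.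
From mathcomp Require Import numfun.

Set Implicit Arguments.
Unset Strict Implicit.
Unset Printing Implicit Defensive.

Import GRing.Theory.
Local Open Scope classical_set_scope.
Local Open Scope ring_scope.

(** Let I be a nonzero ideal of the partial skew group ring. The argument
follows the classical two steps.

Step one: I contains the indicator of a nonempty cylinder, placed at the
neutral element of the free group. A multiplication by 1_(p^-1) delta_(p^-1)
moves a nonzero coefficient to the neutral element ([ideal_coef1]). That
coefficient is locally constant on the boundary X ([D0_locally_constant]), so it
is a nonzero constant k on a small cylinder. The other coefficients, at finitely
many group elements q <> 1, are then cut away: if C is a cylinder such that
theta_(q^-1) maps no point of C into C, then multiplying by 1_C on both sides
kills the coefficient at q. Such cylinders exist inside every cylinder because
the partial action is topologically free ([ex_agree_moved], [ex_agree_disjoint]),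
and this is where condition (L) enters. Indeed, if q = a b^-1 is reduced and
fixes a.z, then z is periodic: after exchanging q and q^-1 if necessary, b = a c
with c a nonempty closed path, and z = c.z. Hence z = c.c.c... is determined by q, so that
q fixes at most one point ([fixed_point_unique]), and leaving z after n turns by
an exit of c gives a different point as close to a.z as desired ([cycle_exit]).

Step two: let H be the set of the vertices v such that I contains
1_v delta_1. Conjugation by delta_p exchanges 1_p and 1_(p^-1)
([ideal_part_conj]); for p = a path, it turns the cylinder of the path into the
vertex set of its range, so H is nonempty by step one. The same identity for
p = an edge, and the decomposition of X_v into the cylinders of the edges that
leave v, make H hereditary and saturated. So H contains all the vertices. Every
element of the ring is supported over finitely many vertices, which gives it a
left unit in I, and I is the whole ring. *)

(** * Quotients of positive words in the free group *)

Section Words.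
Variable T : choiceType.
Implicit Types (a b : seq T) (c : free_group T).

(** The letters of a b^-1, without any cancellation. *)
Definition quot_word a b : seq (T * bool) :=
  [seq (e, true) | e <- a] ++ rev [seq (e, false) | e <- b].

Lemma word_inv_quot a b : word_inv (quot_word a b) = quot_word b a.
Proof.
rewrite /word_inv /quot_word map_cat rev_cat map_rev revK -!map_comp.
by congr (_ ++ rev _).
Qed.

Lemma filter_quot_pos a b :
  [seq x.1 | x <- quot_word a b & x.2] = a.
Proof.
rewrite filter_cat filter_rev !filter_map map_cat map_rev.
have -> : preim (fun e : T => (e, true)) snd = predT by [].
have -> : preim (fun e : T => (e, false)) snd = pred0 by [].
by rewrite filter_predT filter_pred0 -map_comp map_id cats0.
Qed.

Lemma filter_quot_neg a b :
  rev [seq x.1 | x <- quot_word a b & ~~ x.2] = b.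
Proof.
rewrite filter_cat filter_rev !filter_map map_cat map_rev.
have -> : preim (fun e : T => (e, true)) (fun x => ~~ x.2) = pred0 by [].
have -> : preim (fun e : T => (e, false)) (fun x => ~~ x.2) = predT by [].
by rewrite filter_predT filter_pred0 /= revK -map_comp map_id.
Qed.

Lemma reduced_pos a : reduced [seq (e, true) | e <- a].
Proof.
case: a => //= e a; elim: a e => //= f a IHa e.
by rewrite IHa andbT xpair_eqE andbF.
Qed.

Lemma reduced_neg a : reduced (rev [seq (e, false) | e <- a]).
Proof.
have := word_inv_reduced (reduced_pos a).
by rewrite /word_inv -map_comp.
Qed.

Lemma reduced_quot e a f b :
  reduced (quot_word (e :: a) (f :: b)) = (last e a != last f b).
Proof.
rewrite /reduced /quot_word /= cat_path.
have /= -> := reduced_pos (e :: a).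
have := reduced_neg (f :: b); rewrite /reduced.
case: (lastP b) => [|b' g].
  rewrite last_map /= /letter_inv /= => _; rewrite andbT.
  by rewrite xpair_eqE andbT eq_sym.
rewrite -map_cons -rcons_cons map_rcons rev_rcons /= => ->; rewrite andbT.
rewrite last_map /letter_inv /= last_rcons.
by rewrite xpair_eqE andbT eq_sym.
Qed.

Lemma foldr_push_cat (u w : seq (T * bool)) :
  reduced (u ++ w) -> foldr (@push T) w u = u ++ w.
Proof.
elim: u => //= x u IHu ruw; rewrite IHu; last exact: path_sorted ruw.
exact: push_cons.
Qed.

Lemma fg_posE c a b : fg_word c = quot_word a b -> fg_pos c = a.
Proof. by rewrite /fg_pos => ->; apply: filter_quot_pos. Qed.

Lemma fg_negE c a b : fg_word c = quot_word a b -> fg_neg c = b.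
Proof. by rewrite /fg_neg => ->; apply: filter_quot_neg. Qed.

Lemma fg_word_prod_gen a :
  fg_word (\prod_(e <- a) fg_gen e)%g = quot_word a [::].
Proof.
rewrite /quot_word cats0; elim: a => [|e a IHa]; first by rewrite big_nil.
rewrite big_cons /= IHa; apply: push_cons; exact: (reduced_pos (e :: a)).
Qed.

Lemma fg_wordV c a b :
  fg_word c = quot_word a b -> fg_word c^-1%g = quot_word b a.
Proof. by move=> cab; rewrite -word_inv_quot -cab. Qed.

End Words.

(** * Boundary paths and their prefixes *)

Section Paths.
Variable E : digraph.
Implicit Types (a b : seq (edge E)) (v : vertex E) (e : edge E).
Implicit Types (x y z : raw_path E).

Definition prepend a z := foldr (@raw_cons E) z a.
Definition raw_drop n x := iter n (@raw_behead E) x.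

(** The source of the path a, in the case where it ends at v: the vertex v only
matters when a is empty. *)
Definition start a v := if a is e :: _ then src e else v.

(** The possibly empty list a is a path that ends at v; any a.z with z in the
boundary and [path_to a (raw_src z)] is then in the boundary. *)
Fixpoint path_to a v :=
  if a is e :: a' then rng e = start a' v /\ path_to a' v else True.

Lemma path_toE e a v :
  path_to (e :: a) v <-> path (@composable E) e a /\ rng (last e a) = v.
Proof.
elim: a e => [|f a IHa] e; first by split=> [[->]|[]].
split=> [[ef /IHa[pa la]]|/= [/andP[/eqP ef pa] la]].
  by split=> //=; rewrite pa andbT; apply/eqP.
by split=> //; apply/IHa.
Qed.

Lemma path_to_fp (a : finpath E) v : path_to (fp_seq a) v <-> fp_rng a = v.
Proof.
rewrite /fp_seq path_toE; split=> [[]//|av]; split=> //; exact: finpathP.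
Qed.

Lemma path_to_cat a b v :
  path_to (a ++ b) v <-> path_to a (start b v) /\ path_to b v.
Proof.
elim: a => [|e a IHa] /=; first by split=> [|[]].
rewrite IHa; have -> : start (a ++ b) v = start a (start b v) by case: (a).
tauto.
Qed.

Lemma raw_src_cons e z : raw_src (raw_cons e z) = src e.
Proof. by case: z. Qed.

Lemma raw_src_prepend a z : raw_src (prepend a z) = start a (raw_src z).
Proof. by case: a => //= e a; rewrite raw_src_cons. Qed.

Lemma prepend_cat a b z : prepend (a ++ b) z = prepend a (prepend b z).
Proof. exact: foldr_cat. Qed.

Lemma raw_take_cons n e z : raw_take n.+1 (raw_cons e z) = e :: raw_take n z.
Proof.
case: z => [v|f w|f] //=; rewrite /mkseq /= -[1%N]addn0 iotaDl -map_comp.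
by congr (_ :: _); apply: eq_map => i /=; rewrite add1n.
Qed.

Lemma raw_take_prepend a n z :
  raw_take (size a + n) (prepend a z) = a ++ raw_take n z.
Proof. by elim: a => //= e a IHa; rewrite raw_take_cons IHa. Qed.

Lemma raw_take0 z : raw_take 0 z = [::].
Proof. by case: z => //= e w; rewrite take0. Qed.

Lemma raw_take_size a z : raw_take (size a) (prepend a z) = a.
Proof. by rewrite -[size a]addn0 raw_take_prepend raw_take0 cats0. Qed.

(** The hypothesis matters when z is a vertex, since [raw_cons] forgets it. *)
Lemma raw_beheadK e z : rng e = raw_src z -> raw_behead (raw_cons e z) = z.
Proof. by case: z => [v /= ->|//|f //]. Qed.

Lemma raw_drop_prepend a z :
  path_to a (raw_src z) -> raw_drop (size a) (prepend a z) = z.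
Proof.
elim: a => // e a IHa [ea pa].
by rewrite /raw_drop [size _]/= iterSr raw_beheadK ?raw_src_prepend //; apply: IHa.
Qed.

Lemma boundary_cons e z :
  rng e = raw_src z -> boundary E z -> boundary E (raw_cons e z).
Proof.
case: z => [v|f w|f] /= ez; first by rewrite ez.
  by move=> [-> ?]; rewrite andbT; split=> //; apply/eqP.
by move=> bf [|n].
Qed.

Lemma boundary_prepend a z :
  path_to a (raw_src z) -> boundary E z -> boundary E (prepend a z).
Proof.
elim: a => //= e a IHa [ea pa] bz; apply: boundary_cons; last exact: IHa.
by rewrite raw_src_prepend.
Qed.

(** One step of a boundary path. Together with [raw_cons] and [raw_src], this
spares most of the case distinctions between vertices, finite and infinite
paths. *)
Variant raw_spec x : Prop :=
| RawSink v of x = Vtx v & sink v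
| RawCons e z of x = raw_cons e z & rng e = raw_src z & boundary E z.

Lemma boundaryP x : boundary E x -> raw_spec x.
Proof.
case: x => [v sv|e w|f bf]; first exact: (RawSink erefl sv).
  case: w => [|f w] /= [pw sw]; first exact: (@RawCons _ e (Vtx (rng e))).
  by case/andP: pw => /eqP ef pw; apply: (@RawCons _ e (Fin f w)).
apply: (@RawCons _ (f 0%N) (Inf (fun n => f n.+1))) => //=.
by congr Inf; apply/funext => -[].
Qed.

Lemma boundary_takeP a x : boundary E x -> raw_take (size a) x = a ->
  exists z, [/\ x = prepend a z, path_to a (raw_src z) & boundary E z].
Proof.
elim: a x => [|e a IHa] x; first by exists x.
move=> /boundaryP[v -> _ //|f z -> fz bz] /=.
rewrite raw_take_cons => -[fe /(IHa _ bz)[z' [zz' pz' bz']]]; exists z'.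
by split=> //=; [rewrite -fe zz'|rewrite -fe -raw_src_prepend -zz'].
Qed.

Lemma sink_boundary x : boundary E x -> sink (raw_src x) -> x = Vtx (raw_src x).
Proof.
move=> /boundaryP[v -> //|e z -> _ _]; rewrite raw_src_cons => s.
by have : [set f | src f = src e] e by []; rewrite s.
Qed.

(** Choose an edge out of every vertex that is not a sink and walk along these
edges: either the walk meets a sink, or it is an infinite path. *)
Lemma ex_boundary v : exists2 x, boundary E x & raw_src x = v.
Proof.
case: (pselect (sink v)) => [sv|nv]; first by exists (Vtx v).
have [e0 _] : exists e0, src e0 = v.
  by apply: contrapT => /forallNP ne; apply: nv; rewrite /sink -subset0 => e /ne.
have /choice[nxt nxtP] : forall u, exists e, ~ sink u -> src e = u.
  move=> u; case: (pselect (sink u)) => [su|nu]; first by exists e0.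
  apply: contrapT => /forallNP ne; apply: nu; rewrite /sink -subset0 => e eu.
  by apply: (ne e).
pose walk n := iter n (fun u => rng (nxt u)) v.
case: (pselect (exists n, sink (walk n))) => [[n]|ns].
  rewrite /walk; elim: n v {nv walk} => [|n IHn] v sn; first by exists (Vtx v).
  case: (pselect (sink v)) => [sv|nv]; first by exists (Vtx v).
  move: sn; rewrite iterSr => /IHn[z bz zv].
  exists (raw_cons (nxt v) z); last by rewrite raw_src_cons nxtP.
  exact: boundary_cons.
exists (Inf (fun n => nxt (walk n))) => /= [n|]; last exact: nxtP.
by rewrite [RHS]nxtP // => s; apply: ns; exists n.+1.
Qed.

(** For fixed x, these relations form a basis of neighbourhoods of x, made of
cylinders. Comparing the sources is needed for n = 0 and for vertices, where the
prefixes are empty. *)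
Definition agree n x y := raw_src x = raw_src y /\ raw_take n x = raw_take n y.

Lemma raw_take_take m n x : (m <= n)%N -> take m (raw_take n x) = raw_take m x.
Proof.
move=> mn; case: x => [//|e w|f]; first exact: take_takel.
by rewrite /= /mkseq -map_take take_iota (minn_idPl mn).
Qed.

Lemma agree_le m n x y : (m <= n)%N -> agree n x y -> agree m x y.
Proof. by move=> mn [s t]; split; rewrite // -!(raw_take_take _ mn) t. Qed.

Lemma agree_sym n x y : agree n x y -> agree n y x.
Proof. by case. Qed.

Lemma agree_trans n x y z : agree n x y -> agree n y z -> agree n x z.
Proof. by move=> [s t] [s' t']; split; rewrite ?s ?t. Qed.

Lemma agree_cons n e x y : agree n x y -> agree n.+1 (raw_cons e x) (raw_cons e y).
Proof. by move=> [s t]; split; rewrite ?raw_src_cons // !raw_take_cons t. Qed.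

Lemma agree_prepend n a x y :
  agree n x y -> agree (size a + n) (prepend a x) (prepend a y).
Proof. by move=> nxy; elim: a => //= e a IHa; apply: agree_cons. Qed.

Lemma agree_prepend_inv n a x y : raw_src x = raw_src y ->
  agree (size a + n) (prepend a x) (prepend a y) -> agree n x y.
Proof.
by move=> s [_]; rewrite !raw_take_prepend => /eqP; rewrite eqseq_cat// eqxx => /eqP.
Qed.

Lemma path_to_rng e a u v : path_to (e :: a) u -> path_to (e :: a) v -> u = v.
Proof. by move=> /path_toE[_ <-] /path_toE[_ <-]. Qed.

(** Prefixes longer than a finite path show that it ends, and where. *)
Lemma eq_agree x y : boundary E x -> boundary E y -> (forall n, agree n x y) -> x = y.
Proof.
case: x y => [v|e w|f] [v'|e' w'|f'] bx by_ nxy;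
  try by have [_] := nxy 1%N; rewrite /= ?take0.
- by have [/= ->] := nxy 0%N.
- have [_ /=] := nxy (maxn (size w) (size w')).+1.
  by rewrite /= !take_oversize ?leq_maxl ?leq_maxr // => -[-> ->].
- have [_ /(congr1 size)] := nxy (size w).+2; rewrite size_mkseq /= take_oversize //.
  by move=> /eqP; rewrite eqSS ltn_eqF.
- have [_ /(congr1 size)] := nxy (size w').+2; rewrite size_mkseq /= take_oversize //.
  by move=> /eqP; rewrite eqSS gtn_eqF.
congr Inf; apply/funext => n; have [_ /(congr1 (fun s => nth (f 0%N) s n))] := nxy n.+1.
by rewrite /= !nth_mkseq.
Qed.

(** If x is shorter than n, then it ends at a sink, and a path that begins with
x is x itself; so comparing the prefix of length at most n is enough. *)
Lemma agree_takeP n x y : boundary E x -> boundary E y ->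
  agree n x y <->
  raw_src x = raw_src y /\
  raw_take (size (raw_take n x)) y = raw_take n x.
Proof.
move=> bx by_; set a := raw_take n x.
have sa : (size a <= n)%N.
  by rewrite /a; case: (x) => [v|e w|f] //=;
    rewrite ?size_mkseq // size_take_min geq_minl.
have xa : raw_take (size a) x = a.
  rewrite /a -[in LHS](raw_take_take x sa); apply: take_size.
split=> [[s t]|[s t]].
  by split=> //; rewrite -(raw_take_take _ sa) -t take_size.
split=> //; have [san|] := ltnP (size a) n; last first.
  by move=> na; have := t; rewrite (_ : size a = n) //; apply/eqP; rewrite eqn_leq sa.
have [z [xz pz bz]] := boundary_takeP bx xa.
have [z' [yz pz' bz']] := boundary_takeP by_ t.
have sz : raw_src z = raw_src z'.
  case: (a) xz yz pz pz' => [|e a'] xz yz pz pz'; last exact: path_to_rng pz pz'.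
  by have := s; rewrite xz yz.
have : raw_take n (prepend a z) = a by rewrite -xz.
rewrite -{1}(subnKC (ltnW san)) raw_take_prepend -[RHS]cats0 => /eqP.
rewrite eqseq_cat // eqxx /=.
case/boundaryP: bz (sz) xz => [v -> sv /= vz' xz _|e w -> ew bw _ _].
  suff : z' = Vtx v by rewrite yz xz => ->.
  by rewrite vz'; apply: sink_boundary; rewrite // -vz'.
by rewrite -(prednK (n := n - size a)) ?subn_gt0 // raw_take_cons.
Qed.

End Paths.

(** * Topological freeness of the partial action *)

Section PartialAction.
Variable E : digraph.
Implicit Types (a b : seq (edge E)) (v : vertex E) (e : edge E).
Implicit Types (z : raw_path E) (x y : boundary E) (c : free_group (edge E)).

Lemma boundary_val x : boundary E (val x).
Proof. exact: set_mem (valP x). Qed.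

Lemma ex_finpath e a v : path_to (e :: a) v ->
  exists2 p : finpath E, fp_seq p = e :: a & fp_rng p = v.
Proof. by move=> /path_toE[pa la]; exists (FinPath pa). Qed.

Lemma fp_fg_word (p : finpath E) :
  fg_word (fp_fg p) = quot_word (fp_seq p) [::].
Proof. exact: fg_word_prod_gen. Qed.

Lemma XcylP (p : finpath E) x : Xcyl p x <->
  exists z, [/\ val x = prepend (fp_seq p) z, raw_src z = fp_rng p & boundary E z].
Proof.
split=> [px|[z [xz rz bz]]].
  have [z [xz pz bz]] := boundary_takeP (boundary_val x) px.
  by exists z; split=> //; apply/esym/path_to_fp.
by rewrite /Xcyl /= xz (raw_take_size (fp_seq p)).
Qed.

(** The symmetric form of the four cases that define X_c: x = a.z is in X_c for
c = a b^-1 when b.z is a path too, and then theta_(c^-1) x = b.z. It makes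
the passage from c to c^-1 an exchange of a and b. *)
Definition splits c x a b z :=
  [/\ fg_word c = quot_word a b, val x = prepend a z, path_to a (raw_src z),
      path_to b (raw_src z) & boundary E z].

Lemma fg_mul_quot (p q : finpath E) : fp_last p != fp_last q ->
  fg_word (fp_fg p * (fp_fg q)^-1)%g = quot_word (fp_seq p) (fp_seq q).
Proof.
move=> pq; have -> : fg_word (fp_fg p * (fp_fg q)^-1)%g =
  foldr (@push _) (fg_word (fp_fg q)^-1%g) (fg_word (fp_fg p)) by [].
rewrite (fg_wordV (fp_fg_word q)) fp_fg_word /quot_word cats0 cat0s.
by apply: foldr_push_cat; rewrite -/(quot_word _ _) reduced_quot.
Qed.

Lemma XsetP c x : Xset c x <-> exists a b z, splits c x a b z.
Proof.
split=> [[->|[p -> px]|[p -> /XcylP[z [xz zp bz]]]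
  |[p [q [pq lpq -> /XcylP[z [xz zp bz]]]]]]|].
- by exists [::], [::], (val x); split=> //; apply: boundary_val.
- exists [::], (fp_seq p), (val x); split=> //; last exact: boundary_val.
    exact: (fg_wordV (fp_fg_word p)).
  exact/path_to_fp.
- exists (fp_seq p), [::], z; split=> //; first exact: fp_fg_word.
  exact/path_to_fp.
- exists (fp_seq p), (fp_seq q), z; split=> //.
  + exact/fg_mul_quot/eqP.
  + exact/path_to_fp.
  + by apply/path_to_fp; rewrite zp pq.
move=> [a [b [z [cab xz pa pb bz]]]].
case: a cab xz pa => [|e a] cab xz pa; case: b cab pb => [|f b] cab pb.
- by apply: Or41; apply: val_inj.
- have [q sq rq] := ex_finpath pb; apply: Or42; exists q.
    by apply: val_inj; rewrite [RHS](fg_wordV (fp_fg_word q)) sq.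
  by rewrite /Xsrc /= xz.
- have [p sp rp] := ex_finpath pa; apply: Or43; exists p.
    by apply: val_inj; rewrite [RHS]fp_fg_word sp.
  by apply/XcylP; exists z; rewrite sp.
have [p sp rp] := ex_finpath pa; have [q sq rq] := ex_finpath pb.
have lpq : fp_last p != fp_last q.
  have := fg_wordP c; rewrite cab reduced_quot /fp_last.
  by case: sp => -> ->; case: sq => -> ->.
apply: Or44; exists p, q; split; [by rewrite rp|exact/eqP| |].
  by apply: val_inj; rewrite [RHS]fg_mul_quot // sp sq.
by apply/XcylP; exists z; rewrite sp.
Qed.

Lemma theta_splits c x a b z : splits c x a b z ->
  val (theta c^-1%g x) = prepend b z.
Proof.
move=> [cab xz pa pb bz]; have cV := fg_wordV cab.
have thE : raw_theta c^-1%g (val x) = prepend b z.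
  by rewrite /raw_theta (fg_posE cV) (fg_negE cV) xz [iter _ _ _]raw_drop_prepend.
by rewrite /theta insubdK thE //; apply/mem_set/boundary_prepend.
Qed.

Lemma splitsV c x a b z : splits c x a b z -> splits c^-1%g (theta c^-1%g x) b a z.
Proof.
by move=> s; have t := theta_splits s; case: s => *; split=> //; apply: fg_wordV.
Qed.

Lemma Xset_theta c x : Xset c x -> Xset c^-1%g (theta c^-1%g x).
Proof.
by move=> /XsetP[a [b [z /splitsV s]]]; apply/XsetP; exists b, a, z.
Qed.

Lemma thetaK c x : Xset c x -> theta c (theta c^-1%g x) = x.
Proof.
move=> /XsetP[a [b [z s]]]; apply: val_inj; have /theta_splits := splitsV s.
by rewrite invgK => ->; case: s.
Qed.

Lemma Xset1 x : Xset 1%g x.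
Proof. exact: Or41. Qed.

Lemma theta1 x : theta 1%g x = x.
Proof. by apply: val_inj; rewrite /theta /= insubdK //; apply: valP. Qed.

(** Whether x = a.z is in X_c depends on a and on the source of z, and
theta_(c^-1) replaces the prefix a by b: hence the continuity of theta, with a
modulus that depends only on c. *)
Lemma splits_agree c x y a b z : splits c x a b z -> agree (size a) (val x) (val y) ->
  exists2 z', splits c y a b z' &
  forall n, agree (size a + n) (val x) (val y) ->
    agree (size b + n) (val (theta c^-1%g x)) (val (theta c^-1%g y)).
Proof.
move=> s [sxy]; have t := theta_splits s; case: s => cab xz pa pb bz.
rewrite {1}xz raw_take_size => /esym ya.
have [z' [yz' pa' bz']] := boundary_takeP (boundary_val y) ya.
have szz' : raw_src z = raw_src z'.
  case: (a) pa pa' xz yz' => [|e w] pa pa' xz yz'; last exact: path_to_rng pa pa'.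
  by move: sxy; rewrite xz yz'.
have s' : splits c y a b z' by split; rewrite -?szz'.
exists z' => // n; rewrite t (theta_splits s') xz yz' => /(agree_prepend_inv szz').
exact: agree_prepend.
Qed.

Lemma Xset_agree c x y :
  agree (size (fg_pos c)) (val x) (val y) -> Xset c x -> Xset c y.
Proof.
move=> nxy /XsetP[a [b [z s]]]; have [cab _ _ _ _] := s.
rewrite (fg_posE cab) in nxy; have [z' s' _] := splits_agree s nxy.
by apply/XsetP; exists a, b, z'.
Qed.

Lemma theta_agree c n x y : Xset c x ->
  agree (size (fg_pos c) + n) (val x) (val y) ->
  agree n (val (theta c^-1%g x)) (val (theta c^-1%g y)).
Proof.
move=> /XsetP[a [b [z s]]]; have [cab _ _ _ _] := s; rewrite (fg_posE cab) => nxy.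
have [z' _ th] := splits_agree s (agree_le (leq_addr _ _) nxy).
exact: agree_le (leq_addl _ _) (th _ nxy).
Qed.

(** From a.z = b.z and |a| <= |b|, the path a is a prefix of b, say b = a c, and
cancelling a leaves z = c.z. If c were empty, then a b^-1 would be reduced only
if a and b were empty, that is, for the neutral element. *)
Lemma splits_fixed c x a b z : c <> 1%g -> (size a <= size b)%N ->
  splits c x a b z -> theta c^-1%g x = x ->
  exists e w, [/\ b = a ++ e :: w, path_to (e :: w) (raw_src z)
                & z = prepend (e :: w) z].
Proof.
move=> c1 sab s fx; have := theta_splits s; rewrite fx.
case: s => cab xz pa pb bz; rewrite xz => ab.
have [w bw] : exists w, b = a ++ w.
  exists (drop (size a) b).
  have := congr1 (take (size a)) (raw_take_size b z).
  by rewrite -ab raw_take_take // raw_take_size => {1}->; rewrite cat_take_drop.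
move: pb ab; rewrite {}bw in cab sab *; rewrite prepend_cat => /path_to_cat[pa' pw] ab.
have zw : z = prepend w z.
  by rewrite -[LHS](raw_drop_prepend pa) ab raw_drop_prepend // raw_src_prepend.
case: w => [|e w] in cab sab pa' pw ab zw *; last by exists e, w.
exfalso; case: a cab {xz pa sab ab pa'} => [|e a] cab; first by apply: c1; apply: val_inj.
by have := fg_wordP c; rewrite cab cats0 reduced_quot eqxx.
Qed.

Lemma fixed_pointV c x : Xset c x -> theta c^-1%g x = x ->
  Xset c^-1%g x /\ theta c^-1^-1%g x = x.
Proof.
move=> cx fx; split; first by rewrite -fx; apply: Xset_theta.
by rewrite invgK -{1}fx thetaK.
Qed.

(** A point fixed by c is fixed by c^-1, so the positive part of c may be assumed
to be the shorter one. *)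
Lemma splits_wlog (P : Prop) c x : c <> 1%g -> Xset c x -> theta c^-1%g x = x ->
  (forall c a b z, c <> 1%g -> (size a <= size b)%N -> splits c x a b z ->
     theta c^-1%g x = x -> P) -> P.
Proof.
move=> c1 cx fx HP; have [a [b [z s]]] := (XsetP _ _).1 cx.
have [sab|/ltnW sba] := leqP (size a) (size b); first exact: HP s fx.
have [cx' fx'] := fixed_pointV cx fx.
apply: (HP c^-1%g b a z) => //; last by rewrite -fx; apply: splitsV.
by move/eqP; rewrite invg_eq1 => /eqP.
Qed.

(** A fixed point is a.c.c.c..., where a and c are determined by the group
element. *)
Lemma fixed_point_unique c x y : c <> 1%g ->
  Xset c x -> theta c^-1%g x = x -> Xset c y -> theta c^-1%g y = y -> x = y.
Proof.
wlog : c / (size (fg_pos c) <= size (fg_neg c))%N => [wl|].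
  have [sc|/ltnW sc] := leqP (size (fg_pos c)) (size (fg_neg c)); first exact: wl.
  move=> c1 cx fx cy fy; have [cx' fx'] := fixed_pointV cx fx.
  have [cy' fy'] := fixed_pointV cy fy; apply: (wl c^-1%g) => //.
    have [a [b [z [cab _ _ _ _]]]] := (XsetP _ _).1 cx.
    have cV := fg_wordV cab; rewrite (fg_posE cV) (fg_negE cV).
    by rewrite (fg_posE cab) (fg_negE cab) in sc.
  by move/eqP; rewrite invg_eq1 => /eqP.
move=> sc c1 /XsetP[a [b [z s]]] fx /XsetP[a' [b' [z' s']]] fy.
have [cab xz _ _ bz] := s; have [cab' yz' _ _ bz'] := s'.
have aa' : a = a' by rewrite -(fg_posE cab) (fg_posE cab').
have bb' : b = b' by rewrite -(fg_negE cab) (fg_negE cab').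
subst a' b'; rewrite (fg_posE cab) (fg_negE cab) in sc.
have [e [w [bw _ zw]]] := splits_fixed c1 sc s fx.
have [e' [w' [bw' _ zw']]] := splits_fixed c1 sc s' fy.
move: bw' zw'; rewrite bw => /eqP; rewrite eqseq_cat // eqxx => /eqP[<- <-] zw'.
(* Both tails satisfy z = c.z, so their agreement propagates along c. *)
suff zz' : z = z' by apply: val_inj; rewrite xz yz' zz'.
apply: eq_agree => // n; elim: n => [|n IHn].
  by rewrite zw zw'; split; rewrite ?raw_take0 // !raw_src_prepend.
rewrite zw zw'; apply: agree_le (agree_prepend (e :: w) IHn).
by rewrite addSn ltnS leq_addl.
Qed.

(** By induction on n, going once around c = e.w before leaving: for n = 0, follow
c = w1.f.w2 up to the edge f that has an alternative t, and continue with t and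
any boundary path; then put c in front of the path found for n. *)
Lemma cycle_exit (hL : condition_L E) e w z n : boundary E z ->
  path_to (e :: w) (raw_src z) -> z = prepend (e :: w) z ->
  exists y : raw_path E, [/\ boundary E y, agree n z y & y <> z].
Proof.
move=> bz pw zw; elim: n => [|n [y [by_ nzy yz]]].
  have [p sp rp] := ex_finpath pw.
  have [|f fp [t tf tnf]] := hL p.
    rewrite rp zw -[fp_src p]/(start (fp_seq p) (raw_src z)) sp.
    by rewrite raw_src_prepend.
  rewrite sp in fp; case/splitPr: fp zw pw {sp} => w1 w2 zw pw.
  have [u bu su] := ex_boundary (rng t).
  have [pw1 [fw2 pw2]] := (path_to_cat _ _ _).1 pw.
  have btu : boundary E (raw_cons t u) by apply: boundary_cons.
  have stu : raw_src (raw_cons t u) = src f by rewrite raw_src_cons.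
  have pw1' : path_to w1 (raw_src (raw_cons t u)) by rewrite stu.
  exists (prepend w1 (raw_cons t u)); split.
  - exact: boundary_prepend.
  - split; last by rewrite !raw_take0.
    by rewrite [in LHS]zw !raw_src_prepend stu; case: (w1).
  rewrite [RHS]zw prepend_cat => /(congr1 (raw_drop (size w1))).
  rewrite !raw_drop_prepend ?raw_src_prepend //.
  by move=> /(congr1 (raw_take 1)); rewrite /= !raw_take_cons => -[].
have syz := nzy.1; exists (prepend (e :: w) y); split.
- by apply: boundary_prepend; rewrite -?syz.
- rewrite zw; apply: agree_le (agree_prepend (e :: w) nzy).
  by rewrite addSn ltnS leq_addl.
rewrite [RHS]zw => /(congr1 (raw_drop (size (e :: w)))).
by rewrite !raw_drop_prepend // -syz.
Qed.

Lemma ex_agree_neq (hL : condition_L E) c x n : c <> 1%g -> Xset c x ->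
  theta c^-1%g x = x -> exists2 y, agree n (val x) (val y) & y <> x.
Proof.
move=> c1 cx fx; apply: (splits_wlog c1 cx fx) => {c1 cx fx}c a b z c1 sab s fx.
have [e [w [_ pw zw]]] := splits_fixed c1 sab s fx.
case: s => _ xz pa _ bz; have [y [by_ nzy yz]] := cycle_exit hL n bz pw zw.
have pay : path_to a (raw_src y) by rewrite -nzy.1.
have bay := boundary_prepend pay by_.
exists (Sub (prepend a y) (mem_set bay)); rewrite ?xz ?SubK.
  exact: agree_le (leq_addl _ _) (agree_prepend a nzy).
move=> /(congr1 val); rewrite SubK xz => /(congr1 (raw_drop (size a))).
by rewrite !raw_drop_prepend.
Qed.

(** Topological freeness. If x itself is fixed, another point close to x is
moved, since the fixed point is unique. *)
Lemma ex_agree_moved (hL : condition_L E) c x n : c <> 1%g -> exists2 y,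
  agree n (val x) (val y) & (Xset c y -> theta c^-1%g y <> y).
Proof.
move=> c1; case: (pselect (Xset c x /\ theta c^-1%g x = x)) => [[cx fx]|nfx].
  have [y nxy yx] := ex_agree_neq hL n c1 cx fx.
  by exists y => // cy fy; apply: yx; apply: fixed_point_unique fx.
by exists x => // cx fx; apply: nfx.
Qed.

(** By continuity, a point y that is moved, or where theta is undefined, has a
cylinder around it that theta makes disjoint from itself. The statement is
inherited by smaller cylinders, so it can be used for several group elements in
turn. *)
Lemma ex_agree_disjoint (hL : condition_L E) c x n : c <> 1%g -> exists y m,
  [/\ agree n (val x) (val y), (n <= m)%N &
   forall u, agree m (val y) (val u) -> Xset c u ->
     ~ agree m (val y) (val (theta c^-1%g u))].
Proof.
move=> c1; have [y nxy my] := ex_agree_moved hL x n c1.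
set k := size (fg_pos c).
case: (pselect (Xset c y)) => [cy|ncy].
  have [m nm] : exists m, ~ agree m (val y) (val (theta c^-1%g y)).
    apply: contrapT => /forallNP all; apply: (my cy); apply: val_inj.
    apply/esym/eq_agree; try exact: boundary_val.
    by move=> m; apply: contrapT; apply: all.
  exists y, (maxn n (k + m)); split=> //; first exact: leq_maxl.
  move=> u nyu cu nyt; apply: nm; have kmle := leq_maxr n (k + m).
  have [s1 t1] := theta_agree cy (agree_le kmle nyu).
  have [s2 t2] : agree m (val y) (val (theta c^-1%g u)).
    by apply: agree_le nyt; apply: leq_trans kmle; apply: leq_addl.
  by split; rewrite ?s1 ?t1.
exists y, (maxn n k); split=> //; first exact: leq_maxl.
move=> u [su tu] cu _; apply: ncy; apply: Xset_agree cu.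
by apply: agree_le (leq_maxr n k) _; split.
Qed.

Lemma ex_agree_disjoint_seq (hL : condition_L E) (s : seq (free_group (edge E))) x n :
  exists y m,
  [/\ agree n (val x) (val y), (n <= m)%N &
   forall q u, q \in s -> q <> 1%g -> agree m (val y) (val u) -> Xset q u ->
     ~ agree m (val y) (val (theta q^-1%g u))].
Proof.
elim: s => [|q s [y [m [xy nm IHs]]]]; first by exists x, n.
have [->|/eqP q1] := eqVneq q 1%g.
  by exists y, m; split=> // q' u; rewrite in_cons => /predU1P[-> //|]; apply: IHs.
have [y' [m' [yy' mm' qd]]] := ex_agree_disjoint hL y m q1.
exists y', m'; split; [exact: agree_trans xy (agree_le nm yy')|exact: leq_trans mm'|].
move=> q' u; rewrite in_cons => /predU1P[-> _|q's q'1 ym q'u y't]; first exact: qd.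
apply: (IHs q' u q's q'1) => //.
  exact: agree_trans yy' (agree_le mm' ym).
exact: agree_trans yy' (agree_le mm' y't).
Qed.

End PartialAction.

(** * Coefficient functions *)

Section LinSpan.
Variables (K : fieldType) (V : lmodType K) (S : set V).

Lemma lin_span_ind (P : set V) : P 0 -> (forall u v, P u -> P v -> P (u + v)) ->
  (forall k u, S u -> P (k *: u)) -> lin_span S `<=` P.
Proof.
move=> P0 PD PZ _ [n [k [u [Su ->]]]].
by apply: big_ind => // i _; apply: PZ.
Qed.

Lemma lin_span0 : lin_span S 0.
Proof. by exists 0%N, (fun=> 0), (fun=> 0); split=> [[]//|]; rewrite big_ord0. Qed.

Lemma lin_spanZ k u : S u -> lin_span S (k *: u).
Proof. by exists 1%N, (fun=> k), (fun=> u); rewrite big_ord1. Qed.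

End LinSpan.

Section SkewRing.
Variables (K : fieldType) (E : digraph).
Local Notation FF := (free_group (edge E)).
Local Notation FX := (boundary E -> K^o).
Implicit Types (f g : FX) (p q r : FF) (x y : boundary E).

Lemma indic_neq0 (A : set (boundary E)) x : ((\1_A : FX) x != 0) = (x \in A).
Proof. by rewrite indicE; case: (x \in A); rewrite ?oner_eq0 ?eqxx. Qed.

Lemma Xset_src p x y : p <> 1%g -> Xset p x -> Xset p y ->
  raw_src (val x) = raw_src (val y).
Proof.
move=> p1 /XsetP[a [b [z [pab -> _ pb _]]]] /XsetP[a' [b' [z' [pab' -> _ pb' _]]]].
have aa' : a = a' by rewrite -(fg_posE pab) (fg_posE pab').
have bb' : b = b' by rewrite -(fg_negE pab) (fg_negE pab').
subst a' b'; rewrite !raw_src_prepend; case: a {pab'} pab => //= pab.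
case: b pb pb' pab => [_ _ pab|e b pb pb' _]; last exact: path_to_rng pb pb'.
by case: p1; apply: val_inj.
Qed.

(** The generators are the indicators of sets that are open and closed with a
uniform modulus: the length of the positive part of p for X_p, and 0 for X_v. *)
Lemma D0_locally_constant f : D0 f -> exists n,
  forall x y, agree n (val x) (val y) -> f x = f y.
Proof.
pose P f := exists n, forall x y, agree n (val x) (val y) -> f x = f y.
have ind_agree (A : set (boundary E)) n :
    (forall x y, agree n (val x) (val y) -> A x -> A y) -> P (\1_A).
  move=> An; exists n => x y nxy; rewrite !indicE; congr (_%:R : K); congr nat_of_bool.
  by apply/idP/idP => /set_mem ?; apply/mem_set;
    [apply: An nxy _|apply: An (agree_sym nxy) _].
apply: (@lin_span_ind _ _ _ P) => [|u v [n un] [m vm]|k u Su].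
- by exists 0%N.
- exists (maxn n m) => x y nxy; congr (_ + _).
    exact/un/(agree_le (leq_maxl n m)).
  exact/vm/(agree_le (leq_maxr n m)).
suff [n un] : P u by exists n => x y /un => uxy; congr (_ *: _).
case: Su => [[p _ ->]|[v ->]].
  by apply: ind_agree => x y; apply: Xset_agree.
by apply: (ind_agree _ 0%N) => x y [sxy _]; rewrite /Xsrc /= sxy.
Qed.

(** For p <> 1 the points of X_p have the same source, so a generator lives over
one vertex. *)
Lemma D0_src_bounded f : D0 f -> exists s : seq (vertex E),
  forall x, f x != 0 -> raw_src (val x) \in s.
Proof.
pose P f := exists s : seq (vertex E), forall x, f x != 0 -> raw_src (val x) \in s.
apply: (@lin_span_ind _ _ _ P) => [|u v [s us] [t vt]|k u Su].
- by exists [::] => x; rewrite eqxx.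
- exists (s ++ t) => x; rewrite mem_cat; have [ux|/us->//] := eqVneq (u x) 0.
  have [vx|/vt->//] := eqVneq (v x) 0; last by rewrite orbT.
  by rewrite [_ x](_ : _ = u x + v x) // ux vx addr0 eqxx.
suff [s us] : P u.
  exists s => x; rewrite [_ x](_ : _ = k * u x) //.
  by rewrite mulf_eq0 negb_or => /andP[_ /us].
case: Su => [[p p1 ->]|[v ->]]; last first.
  exists [:: v] => x; rewrite indic_neq0 => /set_mem <-.
  exact: mem_head.
case: (pselect (Xset p !=set0)) => [[y py]|np].
  exists [:: raw_src (val y)] => x; rewrite indic_neq0 => /set_mem px.
  by rewrite (Xset_src p1 px py) mem_head.
exists [::] => x; rewrite indic_neq0 => /set_mem px.
by case: np; exists x.
Qed.

Definition cylinder n x : set (boundary E) := [set y | agree n (val x) (val y)].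

Lemma cylinder_Xset n x :
  cylinder n x = Xsrc (raw_src (val x)) \/
  exists p : finpath E, cylinder n x = Xset (fp_fg p).
Proof.
have bx := boundary_val x; have aP y := agree_takeP n bx (boundary_val y).
case ta : (raw_take n (val x)) => [|e a]; [left|right].
  apply/seteqP; split=> y; first by move=> [].
  by move=> yx; apply/aP; rewrite ta raw_take0.
have xa : raw_take (size (e :: a)) (val x) = e :: a.
  by rewrite -ta; exact: ((aP x).1 _).2.
have [z [xz pa bz]] := boundary_takeP bx xa.
have [p sp rp] := ex_finpath pa; exists p.
apply/seteqP; split=> y.
  move=> /aP[_]; rewrite ta => ya; apply: Or43; exists p => //.
  by rewrite -[Xcyl p y]/(raw_take (size (fp_seq p)) (val y) = fp_seq p) sp.
move=> /XsetP[a' [b' [z' [pab yz _ _ _]]]].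
have := fg_posE pab; rewrite (fg_posE (fp_fg_word p)) sp => aa'.
apply/aP; rewrite ta yz -aa' raw_take_size; split=> //.
by rewrite xz !raw_src_prepend.
Qed.

Lemma D0_Xset k p : p <> 1%g -> D0 (k *: \1_(Xset p) : FX).
Proof. by move=> p1; apply: lin_spanZ; left; exists p. Qed.

Lemma fp_fg_neq1 (p : finpath E) : fp_fg p <> 1%g.
Proof. by move=> /(congr1 (@fg_word _)); rewrite fp_fg_word. Qed.

Lemma fp_fgV_neq1 (p : finpath E) : (fp_fg p)^-1%g <> 1%g.
Proof. by move/eqP; rewrite invg_eq1 => /eqP/fp_fg_neq1. Qed.

Lemma D0_cylinder k n x : D0 (k *: \1_(cylinder n x) : FX).
Proof.
have [->|[p ->]] := cylinder_Xset n x; last exact/D0_Xset/fp_fg_neq1.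
by apply: lin_spanZ; right; eexists.
Qed.

Lemma Xset_fpV (p : finpath E) : Xset (fp_fg p)^-1%g = Xsrc (fp_rng p).
Proof.
apply/seteqP; split=> x; last by move=> xp; apply: Or42; exists p.
have pw := fg_wordV (fp_fg_word p).
move=> /XsetP[a [b [z [pab xz _ pb _]]]].
have := fg_posE pab; rewrite (fg_posE pw) => a0.
have := fg_negE pab; rewrite (fg_negE pw) => b0.
rewrite -a0 in xz; rewrite -b0 in pb.
by rewrite /Xsrc /= xz; apply/esym/path_to_fp.
Qed.

Lemma D_supp p f x : D p f -> f x != 0 -> Xset p x.
Proof.
move=> [g _ <-] /=; rewrite indicE; case: (boolP (x \in _)) => [/set_mem//|_].
by rewrite mul0r eqxx.
Qed.

Definition edge_path (e : edge E) : finpath E := @FinPath E e [::] isT.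

Lemma Xset_edge (e : edge E) x :
  Xset (fp_fg (edge_path e)) x <-> raw_take 1 (val x) = [:: e].
Proof.
split=> [/XsetP[a [b [z [pab -> _ _ _]]]]|ex]; last by apply: Or43; exists (edge_path e).
have := fg_posE pab; rewrite (fg_posE (fp_fg_word _)) => <-.
exact: (raw_take_size [:: e]).
Qed.

(** * Products with monomials *)

(** The element f delta_p. *)
Definition monomial p f : FF -> FX := fun q => if q == p then f else 0.

(** The indicator of X_1 is the constant 1. *)
Lemma D1E f : D 1%g f <-> D0 f.
Proof.
suff e g : \1_(Xset 1%g) \* g = g by split=> [[g Dg <-]|Df]; [rewrite e|exists f].
by apply/funext => x /=; rewrite indicE mem_set ?mul1r //; apply: Xset1.
Qed.

Lemma D_zero p : D p (0 : FX).
Proof.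
exists 0; first exact: lin_span0.
by apply/funext => x; rewrite /= mulr0.
Qed.

Lemma D_ind_Xset p : p <> 1%g -> D p (\1_(Xset p) : FX).
Proof.
move=> p1; exists (\1_(Xset p)); first by rewrite -[\1_ _]scale1r; apply: D0_Xset.
by apply/funext => x; rewrite /= !indicE; case: (_ \in _); rewrite ?mulr1 ?mulr0.
Qed.

Lemma monomial_skew_ring p f : D p f -> skew_ring (monomial p f).
Proof.
move=> Df; split.
  apply: (@sub_finite_set _ _ [set p]) => // q; rewrite /monomial /=.
  by case: eqP.
by move=> q; rewrite /monomial; case: eqP => [->//|_]; apply: D_zero.
Qed.

(** The coefficient of (f delta_p) (g delta_q), in closed form: alpha_(p^-1) and
alpha_p cancel on f. *)
Lemma alpha_twist p f g x : alpha p (alpha p^-1%g f \* g) x =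
  if x \in Xset p then f x * g (theta p^-1%g x) else 0.
Proof.
rewrite /alpha; case: ifPn => // /set_mem px.
by rewrite /= invgK thetaK // mem_set //; apply: Xset_theta.
Qed.

Lemma skew_mul_monomial_l p f (b : FF -> FX) r x : skew_mul (monomial p f) b r x =
  if x \in Xset p then f x * b (p^-1 * r)%g (theta p^-1%g x) else 0.
Proof.
rewrite /skew_mul -(fsbig_widen [set p]) // => [|q [_ qp]].
  by rewrite fsbig_set1 /monomial eqxx alpha_twist.
apply/funext => y; rewrite alpha_twist /monomial; case: eqP => // _.
by rewrite mul0r if_same.
Qed.

Lemma skew_mul_monomial_r (b : FF -> FX) p g r x : skew_mul b (monomial p g) r x =
  let q := (r * p^-1)%g in
  if x \in Xset q then b q x * g (theta q^-1%g x) else 0.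
Proof.
rewrite /skew_mul -(fsbig_widen [set (r * p^-1)%g]) // => [|q [_ qp]].
  have qr : ((r * p^-1)^-1 * r)%g = p by rewrite invgM invgK -mulgA mulVg mulg1.
  by rewrite fsbig_set1 alpha_twist /monomial qr eqxx.
apply/funext => y; rewrite alpha_twist /monomial; case: eqP => [qr|_].
  by case: qp; rewrite -qr invgM invgK mulgA mulgV mul1g.
by rewrite mulr0 if_same.
Qed.

Lemma skew_mul_monomial p f q g : skew_mul (monomial p f) (monomial q g) =
  monomial (p * q)%g (fun x => if x \in Xset p then f x * g (theta p^-1%g x) else 0).
Proof.
apply/funext => r; apply/funext => x; rewrite skew_mul_monomial_l /monomial.
have -> : ((p^-1 * r)%g == q) = (r == (p * q)%g).
  by apply/eqP/eqP => [<-|->]; rewrite mulgA ?mulgV ?mulVg mul1g.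
by case: eqP => // _; rewrite mulr0 if_same.
Qed.

Lemma skew_mul_monomial1_l f (b : FF -> FX) r x :
  skew_mul (monomial 1%g f) b r x = f x * b r x.
Proof.
by rewrite skew_mul_monomial_l mem_set ?invg1 ?mul1g ?theta1 //; apply: Xset1.
Qed.

Lemma skew_mul_monomial1 f g :
  skew_mul (monomial 1%g f) (monomial 1%g g) = monomial 1%g (f \* g).
Proof.
rewrite skew_mul_monomial mul1g; congr monomial; apply/funext => x.
by rewrite mem_set ?invg1 ?theta1 //; apply: Xset1.
Qed.

Lemma skew_ring_src_bounded (a : FF -> FX) : skew_ring a -> exists s : seq (vertex E),
  forall p x, a p x != 0 -> raw_src (val x) \in s.
Proof.
move=> [/finite_seqP[t ta] Da].
have /choice[S aS] p : exists s : seq (vertex E),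
    forall x, a p x != 0 -> raw_src (val x) \in s.
  have [g /D0_src_bounded[s gs] <-] := Da p; exists s => x /=.
  by rewrite mulf_eq0 negb_or => /andP[_ /gs].
exists (flatten [seq S p | p <- t]) => p x apx.
apply/flatten_mapP; exists p; last exact: aS.
have : [set` t] p by rewrite -ta /= => ap0; rewrite ap0 eqxx in apx.
by [].
Qed.

(** * Ideals *)

(** The functions f such that f delta_1 is in I. *)
Definition ideal_part (I : set (FF -> FX)) : set FX :=
  [set f | I (monomial 1%g f)].

Section Ideal.
Variable I : set (FF -> FX).
Hypothesis idI : two_sided_ideal (@skew_mul K E) (@skew_ring K E) I.

Local Notation J := (ideal_part I).

Lemma ideal_partB f g : J f -> J g -> J (f - g).
Proof.
case: idI => _ _ IB _ _ Jf Jg; rewrite /ideal_part /=.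
have -> : monomial 1%g (f - g) = monomial 1%g f - monomial 1%g g.
  apply/funext => q; rewrite -[RHS]/(monomial 1%g f q - monomial 1%g g q).
  by rewrite /monomial; case: eqP; rewrite ?subrr.
exact: IB.
Qed.

Lemma ideal_part0 : J 0.
Proof.
case: idI => _ I0 _ _ _; rewrite /ideal_part /= (_ : monomial _ _ = 0) //.
by apply/funext => q; rewrite /monomial if_same.
Qed.

Lemma ideal_partM f g : D0 f -> J g -> J (f \* g).
Proof.
case: idI => _ _ _ IM _ Df Jg; rewrite /ideal_part /=.
rewrite -skew_mul_monomial1; apply: IM => //.
exact/monomial_skew_ring/D1E.
Qed.

Lemma ideal_part_D0 f : J f -> D0 f.
Proof. by case: idI => IA _ _ _ _ /IA[_ /(_ 1%g)]; rewrite /monomial eqxx => /D1E. Qed.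

Lemma ideal_part_setU (A B : set (boundary E)) : J \1_A -> J \1_B -> J \1_(A `|` B).
Proof.
move=> JA JB'; have -> : (\1_(A `|` B) : FX) = \1_A - (\1_A \* \1_B - \1_B).
  apply/funext => x.
    rewrite -[RHS]/(\1_A x - (\1_A x * \1_B x - \1_B x)) !indicE in_setU.
    by case: (x \in A); case: (x \in B);
      rewrite ?mulr1 ?mulr0 ?mul0r ?subrr ?subr0 ?sub0r ?opprK.
by apply: (ideal_partB _ (ideal_partB (ideal_partM _ _) _)) => //; apply: ideal_part_D0.
Qed.

Lemma ideal_part_bigcup (T : choiceType) (s : seq T) (A : T -> set (boundary E)) :
  (forall t, t \in s -> J \1_(A t)) -> J \1_(\bigcup_(t in [set` s]) A t).
Proof.
move=> Js; rewrite bigcup_seq big_seq.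
apply: (big_ind (fun B => J \1_B)) => //; last exact: ideal_part_setU.
rewrite (_ : \1_ _ = 0); first exact: ideal_part0.
by apply/funext => x; rewrite indicE in_set0.
Qed.

(** With u = 1_p delta_p and u' = 1_(p^-1) delta_(p^-1), the product u' 1_p u is
1_(p^-1). *)
Lemma ideal_part_conj p : p <> 1%g -> J \1_(Xset p) -> J \1_(Xset p^-1%g).
Proof.
move=> p1 Jp; have p1' : p^-1%g <> 1%g by move/eqP; rewrite invg_eq1 => /eqP.
have Dp q : q <> 1%g -> skew_ring (monomial q (\1_(Xset q) : FX)).
  by move=> q1; apply/monomial_skew_ring/D_ind_Xset.
case: idI => _ _ _ IL IR.
have := IR _ _ (Dp p p1) (IL _ _ (Dp _ p1') Jp).
rewrite !skew_mul_monomial mulg1 mulVg.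
have tw x : Xset p^-1%g x -> theta p^-1^-1%g x \in Xset p.
  by move=> px; apply/mem_set; rewrite -[X in Xset X]invgK; apply: Xset_theta.
congr (I (monomial _ _)); apply/funext => x; rewrite !indicE.
by case: (boolP (x \in _)) => // /set_mem px; rewrite tw ?mulr1.
Qed.

(** Multiplying on the right by 1_(p^-1) delta_(p^-1) moves the coefficient at p to
the neutral element, unchanged. *)
Lemma ideal_coef1 : I <> [set 0] -> exists2 a, I a & exists x, a 1%g x != 0.
Proof.
case: idI => IA I0 _ _ IR nI.
have [a Ia [p [x apx]]] : exists2 a, I a & exists p x, a p x != 0.
  apply: contrapT => noI; apply: nI; apply/seteqP; split=> [a Ia|_ -> //].
  apply: contrapT => a0; apply: noI; exists a => //.
  apply: contrapT => all0; apply: a0; apply/funext => p; apply/funext => x.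
  by apply/eqP/negPn/negP => apx; apply: all0; exists p, x.
have [p1|/eqP p1] := eqVneq p 1%g; first by exists a => //; exists x; rewrite -p1.
have p1' : p^-1%g <> 1%g by move/eqP; rewrite invg_eq1 => /eqP.
exists (skew_mul a (monomial p^-1%g \1_(Xset p^-1%g))).
  by apply: IR Ia; apply/monomial_skew_ring/D_ind_Xset.
exists x; rewrite skew_mul_monomial_r /= invgK mul1g.
have px : Xset p x by apply: D_supp apx; case: (IA _ Ia).
by rewrite mem_set // indicE mem_set ?mulr1 //; apply: Xset_theta.
Qed.

(** The cylinder C is chosen so small that the coefficient of a at 1 is constant on
it and that no q <> 1 in the support of a brings a point of C back to C; then
1_C a 1_C = k 1_C. *)
Lemma ideal_cylinder (hL : condition_L E) : I <> [set 0] ->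
  exists n x, J \1_(cylinder n x).
Proof.
move=> /ideal_coef1[a Ia [x ax]]; have [IA _ _ IL IR] := idI.
have [/finite_seqP[s sa] Da] := IA _ Ia.
have [n an] := D0_locally_constant ((D1E _).1 (Da 1%g)).
have [y [m [xy nm ys]]] := ex_agree_disjoint_seq hL s x n.
exists m, y; set C := cylinder m y; set k := a 1%g x in ax.
have DC c : D0 (c *: \1_C : FX) by apply: D0_cylinder.
have SC : skew_ring (monomial 1%g (\1_C : FX)).
  by apply/monomial_skew_ring/D1E; rewrite -[\1_ _]scale1r.
suff Jk : J (k *: \1_C).
  rewrite (_ : \1_C = (k^-1 *: \1_C) \* (k *: \1_C)); first exact: ideal_partM.
  apply/funext => u; rewrite /= -[(_ *: _) u]/(k^-1 * \1_C u) -[(_ *: _) u]/(k * \1_C u).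
  by rewrite indicE; case: (u \in C); rewrite ?mulr0 ?mulr1 ?mulVf.
have := IR _ _ SC (IL _ _ SC Ia); congr I.
apply/funext => r; apply/funext => u; rewrite skew_mul_monomial_r /= invg1 mulg1.
rewrite skew_mul_monomial1_l !indicE /monomial.
have [->|/eqP r1] := eqVneq r 1%g.
  rewrite invg1 theta1 mem_set; last exact: Xset1.
  rewrite -[RHS]/(k * \1_C u) indicE; case: (boolP (u \in C)) => [/set_mem yu|_].
    by rewrite mul1r; congr (_ * _); apply/esym/an/(agree_trans xy)/agree_le/yu.
  by rewrite !mulr0.
case: ifPn => // /set_mem ru.
case: (boolP (u \in C)) => [/set_mem yu|_]; last by rewrite !mul0r.
case: (boolP (_ \in C)) => [/set_mem yt|_]; last by rewrite mulr0.
have [ar0|/eqP ar] := pselect (a r = 0); first by rewrite ar0 mulr0 mul0r.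
have rs : r \in s by have : [set` s] r by rewrite -sa; apply/eqP.
by case: (ys r u rs r1 yu ru yt).
Qed.

Definition ideal_vertices : set (vertex E) := [set v | J \1_(Xsrc v)].

(** Conjugation by a path turns its cylinder into the set of its range. *)
Lemma ideal_vertex_path (p : finpath E) :
  ideal_vertices (fp_rng p) <-> J \1_(Xset (fp_fg p)).
Proof.
rewrite /ideal_vertices /= -Xset_fpV; split; last exact/ideal_part_conj/fp_fg_neq1.
by move=> /ideal_part_conj; rewrite invgK; apply; apply: fp_fgV_neq1.
Qed.

(** The cylinder of an edge lies over its source. *)
Lemma ideal_vertices_hereditary : hereditary ideal_vertices.
Proof.
move=> e Je; apply/(ideal_vertex_path (edge_path e)).
set p := fp_fg _; have Dp : D0 (\1_(Xset p) : FX).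
  by rewrite -[\1_ _]scale1r; apply/D0_Xset/fp_fg_neq1.
rewrite (_ : \1_ _ = \1_(Xset p) \* \1_(Xsrc (src e))); first exact: ideal_partM.
apply/funext => x; rewrite /= !indicE; case: (boolP (x \in Xset p));
  last by rewrite mul0r.
move=> /set_mem/Xset_edge ex; rewrite mul1r mem_set // /Xsrc /=.
have [z [-> _ _]] := @boundary_takeP _ [:: e] _ (boundary_val x) ex.
exact: raw_src_cons.
Qed.

(** X_v is the union of the cylinders of the edges that leave v, because v is not
a sink; this union is finite. *)
Lemma ideal_vertices_saturated : saturated ideal_vertices.
Proof.
move=> v [e0 ve0] /finite_seqP[s vs] vH; rewrite /ideal_vertices /=.
rewrite (_ : Xsrc v = \bigcup_(e in [set` s]) Xset (fp_fg (edge_path e))).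
  apply: ideal_part_bigcup => e es; apply/ideal_vertex_path/vH; exists e => //.
  by rewrite vs.
rewrite -vs; apply/seteqP; split=> [x xv|x [e ev /Xset_edge ex]]; last first.
  have [z [xz _ _]] := @boundary_takeP _ [:: e] _ (boundary_val x) ex.
  by rewrite /Xsrc /= xz raw_src_cons.
case/boundaryP: (boundary_val x) => [u xu su|e z xe _ _].
  move: xv; rewrite /Xsrc /= xu => uv; move: ve0; rewrite -uv => ue0.
  by have : [set e | src e = u] e0 by []; rewrite su.
exists e; first by move: xv; rewrite /Xsrc /= xe raw_src_cons.
by apply/Xset_edge; rewrite xe raw_take_cons raw_take0.
Qed.

(** The indicator of the finitely many vertices over which a lives is a left unit
for a, and it is in I. *)
Lemma ideal_all_vertices : ideal_vertices = setT -> I = @skew_ring K E.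
Proof.
have [IA _ _ _ IR] := idI.
move=> allv; apply/seteqP; split=> // a Sa.
have [s sa] := skew_ring_src_bounded Sa.
pose V := \bigcup_(v in [set` s]) Xsrc v.
have JV : J \1_V.
  by apply: ideal_part_bigcup => v _; rewrite -[J _]/(ideal_vertices v) allv.
have := IR _ _ Sa JV; congr I; apply/funext => p; apply/funext => x.
rewrite skew_mul_monomial1_l; have [->|/sa xs] := eqVneq (a p x) 0; first exact: mulr0.
by rewrite indicE mem_set ?mul1r //; exists (raw_src (val x)).
Qed.

End Ideal.
End SkewRing.

Theorem proposition4p8 (K : fieldType) (E : digraph)
    (hL : condition_L E)
    (hsat : forall H : set (vertex E), hereditary H -> saturated H ->
       H = set0 \/ H = [set: vertex E]) :
  simple_algebra (@skew_mul K E) (@skew_ring K E).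
Proof.
move=> I idI; case: (pselect (I = [set 0])) => [|nI]; [by left|right].
apply: (ideal_all_vertices idI).
have [n [x Jx]] := ideal_cylinder idI hL nI.
have [Hv|//] := hsat _ (ideal_vertices_hereditary idI) (ideal_vertices_saturated idI).
suff [v Iv] : ideal_vertices I !=set0 by rewrite Hv in Iv.
have [Cx|[p Cx]] := cylinder_Xset n x; rewrite Cx in Jx.
  by exists (raw_src (val x)).
by exists (fp_rng p); apply/ideal_vertex_path.
Qed.
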